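(* Let $X$ and $Y$ be Polish spaces and let $A$ be a Borel subset of $X\times Y$ with meager horizontal sections (i.e. $\{x\in X:(x,y)\in A\}$ is meager in $X$ for every $y\in Y$) such that the projection of $A$ on $X$ is non-meager in $X$. Then there exist a copy $P$ of $2^\omega$ in $X$, a copy $Q$ of $2^\omega$ in $Y$, and a homeomorphism $\phi$ from $P$ onto $Q$ such that $$\mathrm{Gr}(\phi)=(P\times Q)\cap A.$$
   Context: A copy of $2^\omega$ in a space is a subspace homeomorphic to the Cantor space $2^\omega$. $\mathrm{Gr}(\phi)$ is the graph $\{(x,\phi(x)):x\in P\}$. *)

(* Defs.v *)
From mathcomp Require Import all_boot all_order all_algebra.
From mathcomp Require Import all_classical all_reals all_analysis.

Set Implicit Arguments.
Unset Strict Implicit.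
Unset Printing Implicit Defensive.

Local Open Scope classical_set_scope.

Definition homeomorphism (S T : topologicalType) (f : S -> T) : Prop :=
  exists g : T -> S,
    [/\ cancel f g, cancel g f, continuous f & continuous g].

Definition homeomorphic (S T : topologicalType) : Prop :=
  exists f : S -> T, homeomorphism f.

Definition separable (T : topologicalType) : Prop :=
  exists2 D : set T, countable D & dense D.

(* Same condition as in the class of complete uniform spaces, which cannot be
   used here because it only has pointed, hence nonempty, instances. *)
Definition complete_metric (R : realType) (M : metricType R) : Prop :=
  forall F : set_system M, ProperFilter F -> cauchy F ->
    exists l : M, F --> l.

Definition completely_metrizable (R : realType) (T : topologicalType) : Prop :=
  exists2 M : metricType R, complete_metric M & homeomorphic T M.

(* [R] is the field in which metrics take their values. *)
Definition polish (R : realType) (T : topologicalType) : Prop :=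
  separable T /\ completely_metrizable R T.

Definition borel (T : topologicalType) : set (set T) :=
  <<s [set U : set T | open U] >>.

Definition nowhere_dense (T : topologicalType) (A : set T) : Prop :=
  interior (closure A) = set0.

Definition meager (T : topologicalType) (A : set T) : Prop :=
  exists2 F : nat -> set T,
    (forall n, nowhere_dense (F n)) & A `<=` \bigcup_n F n.

(* [set_type P] carries the topology induced by the inclusion in [T]. *)
Definition cantor_copy (T : topologicalType) (P : set T) : Prop :=
  homeomorphic (set_type P) cantor_space.

Definition graph (X Y : Type) (P : set X) (Q : set Y)
    (phi : set_type P -> set_type Q) : set (X * Y) :=
  range (fun x : set_type P => (set_val x, set_val (phi x))).

(* Main.v *)
Require Import Defs.
From mathcomp Require Import all_boot all_order all_algebra.
From mathcomp Require Import all_classical all_reals all_analysis.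

(** The proof reduces the statement to finding a Cantor set on which a partial
selector of [A] is in general position.

_A continuous selector._  The Borel set [A] is a Suslin set: its points are
those for which some branch of a tree witnesses membership, and witnessing is a
closed condition ([borel_suslin]).  The branch can be made to code successive
approximations of the second coordinate as well.  For a finite sequence [s],
let [U s] be the open set where the projection of the part of [A] witnessed by
branches through [s] is everywhere non-meager.  The union of the sets
[U (k :: s)] is dense in [U s], and they can be made disjoint without losing
this, so up to a meager set [N] a point of [U [::]] follows exactly one branch.
A point that stays in the open sets along a branch is a limit of points
witnessed by longer and longer parts of it; the second coordinates converge
because the branch codes them, and closedness of the witnessing relation puts
the limit in [A].  So there are a nonempty open [U], a meager [N] and a map [f],
continuous on [U] minus [N], whose graph over [U] minus [N] lies in [A] ([suslin_uniformization]).

_General position._  Let [M] be the set of pairs [(x, z)] with [z] in [U] minus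
[N] and [(x, f z)] in [A].  It has the Baire property, since [A] is Borel and [f]
is continuous, and its sections at fixed [z] are contained in horizontal sections
of [A], hence meager.  By the Kuratowski-Ulam argument [M] is meager
([meager_of_meager_sections]).  Mycielski's construction gives a continuous image
[g c] of the Cantor space inside [U] such that [(g c, g d)] avoids [M] for all
distinct [c] and [d] ([cantor_scheme]).

_Conclusion._  For points of the Cantor space, [(g c, f (g d))] is in [A] exactly
when [c = d].  In particular [g] and [f \o g] are injective, and compactness
makes them embeddings; their images are the required copies, and [f] restricted
to the first is the required homeomorphism. *)

Set Implicit Arguments.
Unset Strict Implicit.
Unset Printing Implicit Defensive.

Import Order.TTheory GRing.Theory Num.Theory.

Local Open Scope classical_set_scope.

(** * Polish spaces without metrics *)

(** Regularity and a countable base in one condition; the sets [B n] may be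
empty, which makes it available on the empty space. *)
Definition regular_base (T : topologicalType) (B : nat -> set T) : Prop :=
  (forall n, open (B n)) /\
  forall (O : set T) (x : T), open O -> O x ->
    exists2 n, B n x & closure (B n) `<=` O.

(** [small n V] stands for the diameter of [V] being small of order [n]. The
third clause is completeness in the form of Cantor's intersection theorem; the
limit is expressed by convergence of the sets, so that the [V n] need not be
closed. *)
Definition complete_gauge (T : topologicalType) (small : nat -> set (set T)) :
    Prop :=
  [/\ forall n (V W : set T), V `<=` W -> small n W -> small n V,
      forall n (x : T), exists V : set T, [/\ open V, V x & small n V]
    & forall V : nat -> set T, (forall n, V n !=set0) ->
        (forall n, V n.+1 `<=` V n) -> (forall n, small n (V n)) ->
        exists x : T, forall O : set T, open O -> O x ->
          exists n, V n `<=` O].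

Lemma nonincreasing_sets (T : Type) (V : nat -> set T) :
  (forall n, V n.+1 `<=` V n) -> forall m n, (m <= n)%N -> V n `<=` V m.
Proof.
move=> Vdec m; elim=> [|n IH]; first by rewrite leqn0 => /eqP ->.
rewrite leq_eqVlt => /orP[/eqP -> //|mn].
by apply: subset_trans (Vdec n) (IH _).
Qed.

Lemma polish_hausdorff (R : realType) (T : topologicalType) :
  polish R T -> hausdorff_space T.
Proof.
move=> [_ [M _ [h [g [hK gK ch cg]]]]] x y xy.
suff : h x = h y by move/(congr1 g); rewrite !hK.
apply: (@metric_hausdorff R M) => U V Ux Vy.
have [z [Uz Vz]] := xy _ _ (ch x U Ux) (ch y V Vy).
by exists (h z).
Qed.

Lemma polish_complete_gauge (R : realType) (T : topologicalType) :
  polish R T -> exists small : nat -> set (set T), complete_gauge small.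
Proof.
move=> [_ [M cM [h [g [hK gK ch cg]]]]].
pose bal (x : M) (n : nat) := ball x (n.+1%:R^-1 : R)%R.
exists (fun n V => exists x : M, V `<=` h @^-1` bal x n); split.
- by move=> n V W VW [x Wx]; exists x; apply: subset_trans Wx.
- move=> n x; exists (h @^-1` (interior (bal (h x) n))); split.
  + move/continuousP: ch; apply; exact: open_interior.
  + rewrite /preimage /=; apply: nbhsx_ballx; by rewrite invr_gt0 ltr0n.
  + exists (h x); apply: preimage_subset; exact: interior_subset.
- move=> V V0 Vdec Vsmall.
  have Vle := nonincreasing_sets Vdec.
  pose F := filter_from [set: nat] (fun n => h @` V n).
  have FF : ProperFilter F.
    apply: filter_from_proper; last by move=> n _; have [x Vx] := V0 n; exists (h x), x.
    apply: filter_from_filter; first by exists 0%N.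
    move=> i j _ _; exists (maxn i j) => // _ [x Vx <-]; split; exists x => //.
      by apply: Vle Vx; rewrite leq_maxl.
    by apply: Vle Vx; rewrite leq_maxr.
  have cF : cauchy F.
    apply: cauchy_exP => e e0.
    have [n _ /(_ n (leqnn n))/= ne] := near_infty_natSinv_lt (PosNum e0).
    have [x xV] := Vsmall n; exists x; exists n => // _ [z Vz <-].
    exact: (le_ball (ltW ne)) (xV _ Vz).
  have [l Fl] := cM F FF cF.
  exists (g l) => O oO Ol.
  have : F (g @^-1` O) by apply: Fl; apply: cg; exact: open_nbhs_nbhs.
  by move=> [n _ hV]; exists n => z Vz; rewrite -(hK z); apply: hV; exists z.
Qed.

Lemma polish_regular_base (R : realType) (T : topologicalType) :
  polish R T -> exists B : nat -> set T, regular_base B.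
Proof.
move=> [[D /countable_injP[f fI] dD] [M _ [h [g [hK gK ch cg]]]]].
pose bal (x : M) (n : nat) := ball x (n.+1%:R^-1 : R)%R.
(* The base is indexed by codes of pairs of a point [d] of the dense set, given
   by its number [f d], and a radius. *)
pose B0 (p : nat * nat) : set T := \bigcup_(d in [set d | D d /\ f d = p.1])
  h @^-1` (interior (bal (h d) p.2)).
exists (fun n => oapp B0 set0 (unpickle n)); split.
- move=> n; case: (unpickle n) => [p|]; last exact: open0.
  apply: bigcup_open => d _; move/continuousP: ch; apply; exact: open_interior.
- move=> O x oO Ox.
  have : nbhs (h x) (g @^-1` O).
    by apply: cg; rewrite hK; exact: open_nbhs_nbhs.
  move=> /nbhs_ballP[e /= e0 xe].
  (* A ball of a quarter of the radius is enough for the triangle inequality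
     through [h d] and a point close to the closure point. *)
  have e20 : (0 < e / 2 / 2)%R by rewrite !divr_gt0.
  have [n _ /(_ n (leqnn n))/= ne] := near_infty_natSinv_lt (PosNum e20).
  have n0 : (0 < n.+1%:R^-1 :> R)%R by rewrite invr_gt0 ltr0n.
  pose W := h @^-1` interior (ball (h x) (n.+1%:R^-1 / 2 : R)%R).
  have oW : open W by move/continuousP: ch; apply; exact: open_interior.
  have Wx : W x by apply: nbhsx_ballx; rewrite divr_gt0.
  have [d [/interior_subset xd Dd]] := dD W (ex_intro _ x Wx) oW.
  exists (pickle (f d, n)); rewrite pickleK /=.
    exists d => //; rewrite /preimage /=; apply/nbhs_ballP.
    exists (n.+1%:R^-1 / 2)%R; first by rewrite /= divr_gt0.
    by move=> z; apply: ball_split; apply: ball_sym.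
  move=> z /(_ (h @^-1` interior (bal (h z) n))) [].
    apply: ch; apply: nbhs_interior; exact: nbhsx_ballx.
  move=> w [[d' [Dd' fd']] /interior_subset dw] /interior_subset zw.
  have {}fd' : d' = d by apply: fI => //; exact: mem_set.
  rewrite fd' in dw; rewrite -(hK z); apply: xe.
  have le4 : (n.+1%:R^-1 <= e / 2 / 2)%R by exact: ltW.
  apply: (@ball_split _ _ (h w)).
    apply: (@ball_split _ _ (h d)); last exact: le_ball le4 _ dw.
    by apply: le_ball xd; rewrite (le_trans _ le4)// ler_pdivrMr// ler_pMr// ler1n.
  apply: le_ball (ball_sym zw); rewrite (le_trans le4)// ler_pdivrMr// ?ler_pMr ?ler1n //.
  by rewrite divr_gt0.
Qed.

(** * Nowhere dense and meager sets *)

Lemma nowhere_denseP (T : topologicalType) (A : set T) :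
  nowhere_dense A <->
  forall W : set T, open W -> W !=set0 ->
    exists W' : set T, [/\ open W', W' !=set0, W' `<=` W & W' `<=` ~` A].
Proof.
split=> [A0 W oW W0|H].
  exists (W `&` ~` closure A); split.
  - apply: openI => //; apply: closed_openC; exact: closed_closure.
  - apply: contrapT => WA0; have [x Wx] := W0.
    suff : (interior (closure A)) x by rewrite A0.
    rewrite /interior nbhsE; exists W => // y Wy.
    by apply: contrapT => Ay; apply: WA0; exists y.
  - exact: subIsetl.
  - by move=> x [_]; apply: contra_not; exact: subset_closure.
rewrite /nowhere_dense -subset0 => x xA.
have [W' [oW' [y W'y] W'A W'nA]] := H _ (open_interior (closure A)) (ex_intro _ x xA).
have [z [Az W'z]] := interior_subset (W'A _ W'y) W' (open_nbhs_nbhs (conj oW' W'y)).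
exact: W'nA W'z Az.
Qed.

Lemma meagerS (T : topologicalType) (A B : set T) :
  A `<=` B -> meager B -> meager A.
Proof. by move=> AB [F nF BF]; exists F => //; exact: subset_trans BF. Qed.

Lemma meager_bigcup (T : topologicalType) (I : countType) (A : I -> set T) :
  (forall i, meager (A i)) -> meager (\bigcup_i A i).
Proof.
move=> mA.
have /choice[F HF] i : exists F : nat -> set T,
    (forall k, nowhere_dense (F k)) /\ A i `<=` \bigcup_k F k.
  by have [F nF AF] := mA i; exists F.
exists (fun n => oapp (fun p : I * nat => F p.1 p.2) set0 (unpickle n)).
  move=> n; case: (unpickle n) => [p|] /=; first by have [] := HF p.1.
  by rewrite /nowhere_dense closure0 interior0.
move=> x [i _ Aix]; have [_ /(_ _ Aix)[m _ Fx]] := HF i.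
by exists (pickle (i, m)) => //; rewrite pickleK.
Qed.

Lemma nowhere_dense_meager (T : topologicalType) (A : set T) :
  nowhere_dense A -> meager A.
Proof. by move=> nA; exists (fun _ => A) => // x Ax; exists 0%N. Qed.

Lemma meager0 (T : topologicalType) : meager (@set0 T).
Proof.
by apply: nowhere_dense_meager; rewrite /nowhere_dense closure0 interior0.
Qed.

Lemma meagerU (T : topologicalType) (A B : set T) :
  meager A -> meager B -> meager (A `|` B).
Proof.
move=> mA mB; rewrite -bigcup2E; apply: meager_bigcup => -[|[|n]] //=.
exact: meager0.
Qed.

Lemma regular_base_open (T : topologicalType) (B : nat -> set T) (W : set T) :
  regular_base B -> open W -> W !=set0 ->
  exists n, [/\ open (B n), B n !=set0 & closure (B n) `<=` W].
Proof.
move=> [oB bB] oW [x Wx]; have [n Bx BW] := bB _ _ oW Wx.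
by exists n; split => //; exists x.
Qed.

Lemma open_prodP (S T : topologicalType) (W : set (S * T)) x y :
  open W -> W (x, y) ->
  exists U V, [/\ open U, open V, U x, V y & U `*` V `<=` W].
Proof.
rewrite openE => /[apply] -[[P Q] /= []].
rewrite (nbhsE x) (nbhsE y) => -[U [oU Ux] UP] [V [oV Vy] VQ] PQW.
exists U, V; split => // -[a b] /= [Ua Vb].
by apply: PQW; split => /=; [exact: UP|exact: VQ].
Qed.

Lemma open_setX (S T : topologicalType) (U : set S) (V : set T) :
  open U -> open V -> open (U `*` V).
Proof.
move=> oU oV; rewrite openE => -[x y] [/= Ux Vy].
by exists (U, V) => //; split; exact: open_nbhs_nbhs.
Qed.

(** * Sections of meager sets *)

(** The exceptional [z] are those whose section meets every nonempty open
subset of some nonempty basic open set [B n]. For fixed [n] they form a nowhere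
dense set: a rectangle inside [B n `*` W] that avoids [N] has a side in [W] free
of exceptional points. *)
Lemma nowhere_dense_section (S T : topologicalType) (B : nat -> set S)
    (N : set (S * T)) : regular_base B -> nowhere_dense N ->
  exists2 E : set T, meager E &
    forall z, ~ E z -> nowhere_dense [set x | N (x, z)].
Proof.
move=> rB /nowhere_denseP nN.
pose D n := [set z : T | B n !=set0 /\ forall W : set S, open W -> W !=set0 ->
  W `<=` B n -> W `&` [set x | N (x, z)] !=set0].
exists (\bigcup_n D n).
  apply: meager_bigcup => n; apply/nowhere_dense_meager/nowhere_denseP => W oW [z Wz].
  have [[x Bx]|B0] := pselect (B n !=set0); last first.
    by exists W; split => //; [exists z|move=> t _ []].
  have [V [oV [[a b] Vab] VW VN]] := nN (B n `*` W)
    (open_setX (rB.1 n) oW) (ex_intro _ (x, z) (conj Bx Wz)).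
  have [V1 [V2 [oV1 oV2 V1a V2b V12]]] := open_prodP oV Vab.
  exists V2; split => //; first by exists b.
    by move=> t V2t; have [] := VW (a, t) (V12 (a, t) (conj V1a V2t)).
  move=> t V2t [_ /(_ V1 oV1 (ex_intro _ a V1a))[]].
    by move=> s V1s; have [] := VW (s, b) (V12 (s, b) (conj V1s V2b)).
  by move=> s [V1s]; exact: VN (V12 (s, t) (conj V1s V2t)).
move=> z nDz; apply/nowhere_denseP => W oW W0.
have [n [oBn Bn0 BnW]] := regular_base_open rB oW W0.
have : ~ D n z by move=> Dnz; apply: nDz; exists n.
move=> /not_andP[//|/existsNP[V /not_implyP[oV /not_implyP[V0 /not_implyP[VB VN]]]]].
exists V; split => //.
  by move=> s /VB Bs; apply: BnW; exact: subset_closure.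
by move=> s Vs Ns; apply: VN; exists s.
Qed.

Lemma kuratowski_ulam (S T : topologicalType) (B : nat -> set S)
    (M : set (S * T)) : regular_base B -> meager M ->
  exists2 E : set T, meager E &
    forall z, ~ E z -> meager [set x | M (x, z)].
Proof.
move=> rB [F nF MF].
have /choice[E HE] n : exists E : set T, meager E /\
    forall z, ~ E z -> nowhere_dense [set x | F n (x, z)].
  by have [E mE HE] := nowhere_dense_section rB (nF n); exists E.
exists (\bigcup_n E n); first by apply: meager_bigcup => n; have [] := HE n.
move=> z nEz; exists (fun n => [set x | F n (x, z)]).
  by move=> n; apply: (HE n).2 => Enz; apply: nEz; exists n.
by move=> x /MF[n _ Fn]; exists n.
Qed.

(** * Cantor schemes *)

(** The first [n] values of [c], latest value first: extending a history is
then consing, and recursion on sequences is recursion along a branch. *)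
Fixpoint history (K : Type) (c : nat -> K) (n : nat) : seq K :=
  if n is m.+1 then c m :: history c m else [::].

Lemma size_history (K : Type) (c : nat -> K) n : size (history c n) = n.
Proof. by elim: n => //= n ->. Qed.

Lemma history_eq (K : Type) (c d : nat -> K) n :
  history c n = history d n -> forall i, (i < n)%N -> c i = d i.
Proof.
elim: n => // n IH [cd /IH H] i; rewrite ltnS leq_eqVlt => /orP[/eqP -> //|].
exact: H.
Qed.

Lemma nbhs_history (c : cantor_space) n :
  nbhs c [set d : cantor_space | history d n = history c n].
Proof.
elim: n => [|n IH]; first by apply: filterS filterT => d.
have H : nbhs c [set d : cantor_space | d n = c n].
  have := @proj_continuous nat (fun _ => bool) n c [set c n].
  by apply; exact: discrete_set1.
by apply: filterS (filterI IH H) => d [/= -> ->].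
Qed.

Definition nonempty_opens (K : Type) (T : topologicalType) (W : K -> set T) :=
  forall k, open (W k) /\ W k !=set0.

(** One triple [(u, v, n)] of [l] at a time: the rectangle [W u `*` W v]
contains a smaller open rectangle that avoids [N n], and its sides replace [W u]
and [W v]. Shrinking further keeps what was achieved for earlier triples. *)
Lemma shrink_off_nowhere_dense (T : topologicalType) (K : eqType)
    (N : nat -> set (T * T)) (l : seq (K * K * nat)) (W : K -> set T) :
  (forall n, nowhere_dense (N n)) -> nonempty_opens W ->
  exists W' : K -> set T, [/\ nonempty_opens W', forall k, W' k `<=` W k
    & forall p, p \in l -> p.1.1 != p.1.2 ->
        W' p.1.1 `*` W' p.1.2 `<=` ~` N p.2].
Proof.
move=> nN oW; elim: l => [|[[u v] n] l [W1 [oW1 W1W W1N]]].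
  by exists W; split => // k.
have [uv|uv] := eqVneq u v.
  exists W1; split => // p; rewrite inE => /orP[/eqP -> /=|]; last exact: W1N.
  by rewrite uv eqxx.
have [[oW1u [a W1a]] [oW1v [b W1b]]] := (oW1 u, oW1 v).
have [V [oV [[x y] Vxy] VW VN]] := (nowhere_denseP _).1 (nN n) _
  (open_setX oW1u oW1v) (ex_intro _ (a, b) (conj W1a W1b)).
have [P [Q [oP oQ Px Qy PQV]]] := open_prodP oV Vxy.
have [W1x W1y] := VW _ Vxy.
exists (fun k => if k == u then P `&` W1 k else if k == v then Q `&` W1 k else W1 k).
split.
- move=> k; case: eqP => [->|_]; first by split; [exact: openI|exists x].
  by case: eqP => [->|_] //; split; [exact: openI|exists y].
- by move=> k z; case: ifP => [_ [_ /W1W]|_] //; case: ifP => [_ [_ /W1W]|_ /W1W].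
- move=> p; rewrite inE => /orP[/eqP -> _ [s t] /= []|pl pne [s t] [/= h1 h2]].
    rewrite eqxx eq_sym (negbTE uv) eqxx => -[Ps _] [Qt _].
    by apply: (VN (s, t)); apply: PQV; split.
  apply: (W1N _ pl pne (s, t)); split => /=.
    by move: h1; case: ifP => [_ []|_] //; case: ifP => [_ []|].
  by move: h2; case: ifP => [_ []|_] //; case: ifP => [_ []|].
Qed.

(** The step from level [n] to level [n.+1] of the scheme. *)
Definition refines (T : topologicalType) (small : nat -> set (set T))
    (N : nat -> set (T * T)) (n : nat) (W W' : seq bool -> set T) : Prop :=
  (forall i u, closure (W' (i :: u)) `<=` W u /\ small n (W' (i :: u))) /\
  forall u v m, size u = n.+1 -> size v = n.+1 -> u != v -> (m <= n)%N ->
    W' u `*` W' v `<=` ~` N m.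

Lemma refinement_exists (T : topologicalType) (B : nat -> set T)
    (small : nat -> set (set T)) (N : nat -> set (T * T))
    (n : nat) (W : seq bool -> set T) :
  regular_base B -> complete_gauge small ->
  (forall n, nowhere_dense (N n)) -> nonempty_opens W ->
  exists W', nonempty_opens W' /\ refines small N n W W'.
Proof.
move=> rB [small_sub small_nbhs _] nN oW.
(* The empty word has no parent; [behead] sends it to itself. *)
have /choice[W1 HW1] (u : seq bool) : exists V : set T,
    [/\ open V, V !=set0, closure V `<=` W (behead u) & small n V].
  have [oWu [x Wx]] := oW (behead u).
  have [V [oV Vx sV]] := small_nbhs n x.
  have [k [oBk Bk0 BkV]] := regular_base_open rB (openI oWu oV)
    (ex_intro _ x (conj Wx Vx)).
  exists (B k); split => //; first by apply: subset_trans BkV _; exact: subIsetl.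
  by apply: small_sub sV => z Bz; apply: (BkV z _).2; exact: subset_closure.
have oW1 : nonempty_opens W1 by move=> u; have [] := HW1 u.
pose words := [seq tval t | t <- enum {: n.+1.-tuple bool}].
pose l := [seq (p, m) | p <- [seq (u, v) | u <- words, v <- words],
                        m <- iota 0 n.+1].
have [W' [oW' W'W1 W'N]] := shrink_off_nowhere_dense l nN oW1.
exists W'; split => //; split.
  move=> i u; have [_ _ cW1 sW1] := HW1 (i :: u); split.
    by apply: subset_trans cW1; exact: closureS.
  exact: small_sub sW1.
move=> u v m su sv uv mn; apply: (W'N (u, v, m)) => //.
have wordsP (w : seq bool) : size w = n.+1 -> w \in words.
  move=> /eqP sw; apply/mapP; exists (Tuple sw) => //; exact: mem_enum.
apply/allpairsP; exists ((u, v), m); split => //.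
  by apply/allpairsP; exists (u, v); split => //; exact: wordsP.
by rewrite mem_iota ltnS.
Qed.

(** Mycielski's theorem. The sets of one level may overlap; [g] is injective as
soon as the sets [N n] cover the diagonal of [U]. *)
Lemma cantor_scheme (T : topologicalType) (B : nat -> set T)
    (small : nat -> set (set T)) (U : set T) (N : nat -> set (T * T)) :
  regular_base B -> complete_gauge small -> open U -> U !=set0 ->
  (forall n, nowhere_dense (N n)) ->
  exists g : cantor_space -> T, [/\ continuous g, forall c, U (g c)
    & forall c d n, c <> d -> ~ N n (g c, g d)].
Proof.
move=> rB cg oU U0 nN.
pose st := {W : seq bool -> set T | nonempty_opens W}.
have /choice[next nextP] (p : nat * st) : exists W' : st,
    refines small N p.1 (sval p.2) (sval W').
  have [W' [oW' W'P]] := refinement_exists p.1 rB cg nN (svalP p.2).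
  by exists (exist _ W' oW').
have oW0 : nonempty_opens (fun _ : seq bool => U) by [].
pose fix W_ n : st := if n is m.+1 then next (m, W_ m) else exist _ _ oW0.
pose W n := sval (W_ n).
have oW n : nonempty_opens (W n) := svalP (W_ n).
have WW n : refines small N n (W n) (W n.+1) := nextP (n, W_ n).
pose V c n := W n (history c n).
have Vcl c n : closure (V c n.+1) `<=` V c n := ((WW n).1 _ _).1.
have Vdec c n : V c n.+1 `<=` V c n.
  by apply: subset_trans (Vcl c n); exact: subset_closure.
have Vle c := nonincreasing_sets (Vdec c).
have [_ _ complete] := cg.
have /choice[g gP] (c : cantor_space) : exists x : T,
    forall O : set T, open O -> O x -> exists n, V c n.+1 `<=` O.
  apply: (complete (fun n => V c n.+1)) => n.
  - exact: (oW _ _).2.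
  - exact: Vdec.
  - exact: ((WW n).1 _ _).2.
have gV c n : V c n (g c).
  apply: Vcl => O; rewrite nbhsE => -[Q [oQ Qg] QO].
  have [m mQ] := gP c Q oQ Qg.
  have [z Vz] := (oW (maxn n.+1 m.+1) (history c (maxn n.+1 m.+1))).2.
  exists z; split; first by apply: Vle Vz; rewrite leq_maxl.
  by apply/QO/mQ; apply: Vle Vz; rewrite leq_maxr.
exists g; split.
- move=> c O; rewrite nbhsE => -[Q [oQ Qg] QO].
  have [n nQ] := gP c Q oQ Qg.
  apply: filterS (nbhs_history c n.+1) => d hd; apply/QO/nQ.
  by rewrite /V -hd; exact: gV.
- by move=> c; exact: (gV c 0%N).
- move=> c d n cd.
  have [k ck] : exists k, c k <> d k.
    by apply/existsNP => H; apply: cd; exact/funext.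
  (* From level [m.+1] on, [c] and [d] have different histories and [N n] is
     among the sets to avoid. *)
  pose m := maxn k n.
  have hcd : history c m.+1 != history d m.+1.
    apply/eqP => /history_eq/(_ k) H; apply: ck; apply: H.
    by rewrite ltnS leq_maxl.
  apply: ((WW m).2 _ _ n (size_history _ _) (size_history _ _) hcd).
    by rewrite leq_maxr.
  by split; exact: gV.
Qed.

Lemma nowhere_dense_setTX (S T : topologicalType) (N : set T) :
  nowhere_dense N -> nowhere_dense ([set: S] `*` N).
Proof.
move=> /nowhere_denseP nN; apply/nowhere_denseP => W oW [[x y] Wxy].
have [P [Q [oP oQ Px Qy PQW]]] := open_prodP oW Wxy.
have [Q' [oQ' [y' Q'y'] Q'Q Q'N]] := nN Q oQ (ex_intro _ y Qy).
exists (P `*` Q'); split; first exact: open_setX.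
- by exists (x, y').
- by move=> [s t] [Ps /Q'Q Qt]; apply: PQW.
- by move=> [s t] [_ /Q'N nNt] [].
Qed.

(** Baire's theorem follows from the Cantor scheme: if the sets [F n] covered
[U], a scheme avoiding the cylinders over them would have points outside all
[F n]. *)
Lemma baire (T : topologicalType) (B : nat -> set T)
    (small : nat -> set (set T)) (U : set T) :
  regular_base B -> complete_gauge small -> open U -> U !=set0 -> ~ meager U.
Proof.
move=> rB cg oU U0 [F nF UF].
have nN n := nowhere_dense_setTX T (nF n).
have [g [_ Ug gN]] := cantor_scheme rB cg oU U0 nN.
have [n _ Fn] := UF _ (Ug (fun _ => true)).
apply: (gN (fun _ => false) (fun _ => true) n _) => //.
by move/(congr1 (fun c : cantor_space => c 0%N)).
Qed.

(** * Suslin sets *)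

Lemma eq_history (K : Type) (c d : nat -> K) n :
  (forall i, (i < n)%N -> c i = d i) -> history c n = history d n.
Proof.
elim: n => // n IH cd /=; rewrite cd// IH// => i ilt; apply: cd; exact: ltnW.
Qed.

Lemma history_le (K : Type) (c d : nat -> K) m n : (m <= n)%N ->
  history c n = history d n -> history c m = history d m.
Proof.
move=> mn /history_eq cd; apply: eq_history => i im; apply: cd.
exact: leq_trans mn.
Qed.

(** Closedness of [C] in the product of [Z] with the Baire space, the space of
all [a : nat -> nat], spelled out with histories as basic neighbourhoods. *)
Definition tree_closed (Z : topologicalType) (C : Z -> (nat -> nat) -> Prop) :=
  forall z a,
    (forall (W : set Z) n, open W -> W z ->
      exists z' b, [/\ W z', history b n = history a n & C z' b]) -> C z a.

(** Projections of closed sets along the Baire space; on Polish spaces these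
are the analytic sets. *)
Definition suslin (Z : topologicalType) (S : set Z) : Prop :=
  exists2 C, tree_closed C & S = [set z | exists a, C z a].

Lemma tree_closed_digit (Z : topologicalType) (F : nat -> set Z) n :
  (forall k, closed (F k)) -> tree_closed (fun z a => F (a n) z).
Proof.
move=> cF z a H; apply: cF => W; rewrite nbhsE => -[Q [oQ Qz] QW].
have [z' [b [Qz' /history_eq/(_ n (ltnSn n)) <- Fz']]] := H Q n.+1 oQ Qz.
by exists z'; split => //; exact: QW.
Qed.

Lemma tree_closed_forall (Z : topologicalType) (I : Type)
    (C : I -> Z -> (nat -> nat) -> Prop) :
  (forall i, tree_closed (C i)) -> tree_closed (fun z a => forall i, C i z a).
Proof.
move=> cC z a H i; apply: cC => W n oW Wz.
by have [z' [b [Wz' ba Cb]]] := H W n oW Wz; exists z', b; split.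
Qed.

Lemma tree_closed_and (Z : topologicalType)
    (C D : Z -> (nat -> nat) -> Prop) :
  tree_closed C -> tree_closed D -> tree_closed (fun z a => C z a /\ D z a).
Proof.
move=> cC cD z a H; split; [apply: cC|apply: cD] => W n oW Wz;
  by have [z' [b [Wz' ba []]]] := H W n oW Wz; exists z', b; split.
Qed.

(** The hypothesis says that [e a i] depends on [a] only through the digit
[a (r i)], which makes [e] continuous. *)
Lemma tree_closed_comp (Z : topologicalType) (C : Z -> (nat -> nat) -> Prop)
    (e : (nat -> nat) -> nat -> nat) (r : nat -> nat) :
  (forall a b i, a (r i) = b (r i) -> e a i = e b i) ->
  tree_closed C -> tree_closed (fun z a => C z (e a)).
Proof.
move=> er cC z a H; apply: cC => W n oW Wz.
have [z' [b [Wz' ba Cb]]] := H W (\max_(i < n) (r i)).+1 oW Wz.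
exists z', (e b); split => //; apply: eq_history => i ilt; apply: er.
apply: (history_eq ba); rewrite ltnS.
exact: (@leq_bigmax _ (fun i : 'I_n => r i) (Ordinal ilt)).
Qed.

Lemma suslin_closed (Z : topologicalType) (F : set Z) : closed F -> suslin F.
Proof.
move=> cF; exists (fun z _ => F z); first exact: (@tree_closed_digit _ (fun _ => F) 0%N).
by apply/seteqP; split => [z Fz|z [_ //]]; exists (fun _ => 0%N).
Qed.

(** One branch codes a branch for each [S n], through a pairing of indices. *)
Lemma suslin_bigcap (Z : topologicalType) (S : nat -> set Z) :
  (forall n, suslin (S n)) -> suslin (\bigcap_n S n).
Proof.
move=> sS.
have /choice[C HC] n : exists C, tree_closed C /\ S n = [set z | exists a, C z a].
  by have [C] := sS n; exists C.
exists (fun z a => forall n, C n z (fun i => a (pickle (n, i)))).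
  apply: tree_closed_forall => n.
  apply: (@tree_closed_comp _ _ (fun a i => a (pickle (n, i))) (fun i => pickle (n, i))) => //.
  exact: (HC n).1.
apply/seteqP; split => [z Sz|z [a Ca] n _]; last first.
  by rewrite (HC n).2; exists (fun i => a (pickle (n, i))).
have /choice[a Ca] n : exists a, C n z a by have := Sz n I; rewrite (HC n).2.
exists (fun k => oapp (fun p => a p.1 p.2) 0%N (unpickle k)) => n.
rewrite (_ : (fun i => _) = a n)//; apply/funext => i; by rewrite pickleK.
Qed.

(** The first digit of a branch tells which [S n] the rest is a witness for. *)
Lemma suslin_bigcup (Z : topologicalType) (S : nat -> set Z) :
  (forall n, suslin (S n)) -> suslin (\bigcup_n S n).
Proof.
move=> sS.
have /choice[C HC] n : exists C, tree_closed C /\ S n = [set z | exists a, C z a].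
  by have [C] := sS n; exists C.
exists (fun z a => C (a 0%N) z (fun i => a i.+1)).
  move=> z a H; apply: (HC (a 0%N)).1 => W n oW Wz.
  have [z' [b [Wz' /history_eq ba Cb]]] := H W n.+1 oW Wz.
  exists z', (fun i => b i.+1); split => //; last by rewrite -ba.
  by apply: eq_history => i ilt; exact: ba.
apply/seteqP; split => [z [n _]|z [a Ca]].
  rewrite (HC n).2 => -[a Ca].
  by exists (fun i => if i is j.+1 then a j else n).
by exists (a 0%N) => //; rewrite (HC _).2; exists (fun i => a i.+1).
Qed.

(** The sets that are Suslin together with their complement form a
sigma-algebra, and it contains the open sets because these are countable unions
of closed sets. *)
Lemma borel_suslin (Z : topologicalType) (S : set Z) :
  (forall O : set Z, open O ->
    exists2 F : nat -> set Z, (forall n, closed (F n)) & O = \bigcup_n F n) ->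
  borel S -> suslin S.
Proof.
move=> openF; suff : borel S -> suslin S /\ suslin (~` S) by move=> H /H[].
apply: (smallest_sub (X := [set S | suslin S /\ suslin (~` S)])); last first.
  move=> Q /= oQ; split; last by apply: suslin_closed; exact: open_closedC.
  by have [F cF ->] := openF Q oQ; apply: suslin_bigcup => n; exact: suslin_closed.
split.
- by split; apply: suslin_closed; [exact: closed0|rewrite setC0; exact: closedT].
- by move=> Q [sQ sQC]; rewrite /= setTD setCK.
- move=> F sF; split; first by apply: suslin_bigcup => n; have [] := sF n.
  by rewrite setC_bigcup; apply: suslin_bigcap => n; have [] := sF n.
Qed.

Lemma open_prod_Fsigma (X Y : topologicalType) (B : nat -> set X)
    (B' : nat -> set Y) (W : set (X * Y)) :
  regular_base B -> regular_base B' -> open W ->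
  exists2 F : nat -> set (X * Y), (forall n, closed (F n)) & W = \bigcup_n F n.
Proof.
move=> [oB rB] [oB' rB'] oW.
pose box (p : nat * nat) := closure (B p.1) `*` closure (B' p.2).
pose F p := if pselect (box p `<=` W) then box p else set0.
have cF p : closed (F p).
  rewrite /F; case: (pselect _) => /= ?; last exact: closed0.
  rewrite (_ : box p =
    fst @^-1` closure (B p.1) `&` snd @^-1` closure (B' p.2))//.
  apply: closedI; apply: preimage_closed => //; try exact: closed_closure.
    by move=> [x y] _; exact: cvg_fst.
  by move=> [x y] _; exact: cvg_snd.
exists (fun n => oapp F set0 (unpickle n)).
  by move=> n; case: unpickle => //=; exact: closed0.
apply/seteqP; split => [[x y] Wxy|z [n _]].
  have [U [V [oU oV Ux Vy UVW]]] := open_prodP oW Wxy.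
  have [i Bx BU] := rB U x oU Ux; have [j By BV] := rB' V y oV Vy.
  exists (pickle (i, j)) => //; rewrite pickleK /= /F; case: (pselect _) => [?|[]].
    by split; exact: subset_closure.
  by move=> [s t] [/BU Us /BV Vt]; apply: UVW.
case: unpickle => //= p; rewrite /F; case: (pselect _) => // H; exact: H.
Qed.

(** * Continuous uniformization on a comeager set *)

(** The largest open set in which [S] is non-meager everywhere; [S] need not be
contained in it, but only a meager part of [S] lies outside. *)
Definition everywhere_nonmeager (T : topologicalType) (S : set T) : set T :=
  \bigcup_(O in [set O | open O /\ forall W : set T, open W -> W !=set0 ->
    W `<=` O -> ~ meager (S `&` W)]) O.

Lemma open_everywhere_nonmeager (T : topologicalType) (S : set T) :
  open (everywhere_nonmeager S).
Proof. by apply: bigcup_open => O []. Qed.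

Lemma everywhere_nonmeager_meet (T : topologicalType) (S W : set T) :
  open W -> W `&` everywhere_nonmeager S !=set0 -> W `&` S !=set0.
Proof.
move=> oW [x [Wx [Q [oQ HQ] Qx]]].
apply: contrapT => WS; apply: (HQ (W `&` Q)).
- exact: openI.
- by exists x.
- exact: subIsetr.
- apply: meagerS (@meager0 T) => z [Sz [Wz _]]; apply: WS; by exists z.
Qed.

(** Otherwise the basic open sets in which [S] is meager have a union that is
dense in [W], so [S `&` W] is meager. *)
Lemma meet_everywhere_nonmeager (T : topologicalType) (B : nat -> set T)
    (S W : set T) : regular_base B -> open W -> ~ meager (S `&` W) ->
  W `&` everywhere_nonmeager S !=set0.
Proof.
move=> rB oW mSW; apply: contrapT => WE; apply: mSW.
pose good n := meager (S `&` B n).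
pose D n := [set x | good n /\ (S `&` B n) x].
pose N := W `\` \bigcup_(n in good) B n.
apply: (@meagerS _ _ ((\bigcup_n D n) `|` N)).
  move=> x [Sx Wx]; have [[n gn Bx]|nx] := pselect ((\bigcup_(n in good) B n) x).
    by left; exists n.
  by right.
apply: meagerU.
  apply: meager_bigcup => n; have [gn|ngn] := pselect (good n).
    by apply: meagerS gn => x [].
  by apply: meagerS (@meager0 T) => x [].
apply/nowhere_dense_meager/nowhere_denseP => V oV [x Vx].
have [Wx|nWx] := pselect (V `&` W !=set0); last first.
  by exists V; split => //; [exists x|move=> z Vz [Wz _]; apply: nWx; exists z].
have [y [Vy Wy]] := Wx.
have : ~ forall Q : set T, open Q -> Q !=set0 -> Q `<=` V `&` W -> ~ meager (S `&` Q).
  move=> H; apply: WE; exists y; split => //; exists (V `&` W) => //; split => //.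
  exact: openI.
move=> /existsNP[Q /not_implyP[oQ /not_implyP[Q0 /not_implyP[QVW /contrapT mQ]]]].
have [n [oBn Bn0 BnQ]] := regular_base_open rB oQ Q0.
have BQ : B n `<=` Q by apply: subset_trans BnQ; exact: subset_closure.
exists (B n); split => //.
  by move=> z /BQ/QVW[].
move=> z Bz [_]; apply; exists n => //.
by apply: meagerS mQ => t [St /BQ].
Qed.

Section Disjointification.
Variables (T : topologicalType) (B : nat -> set T) (P : seq nat -> set T).
Hypothesis rB : regular_base B.
Hypothesis P_cover : forall s, P s `<=` \bigcup_k P (k :: s).

Let U s := everywhere_nonmeager (P s).

(** Among the children of [s], the least [k] wins: from [U (k :: s)] the closure
of the earlier siblings is removed. Removing the closure keeps the sets open and
loses only a nowhere dense set. *)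
Fixpoint disjointed (s : seq nat) : set T :=
  if s is k :: s' then
    disjointed s' `&` (U s `\` closure (\bigcup_(j in [set j | (j < k)%N]) U (j :: s')))
  else U s.

Lemma open_disjointed s : open (disjointed s).
Proof.
elim: s => [|k s IH] /=; first exact: open_everywhere_nonmeager.
apply: openI => //; apply: openI; first exact: open_everywhere_nonmeager.
by apply: closed_openC; exact: closed_closure.
Qed.

Lemma disjointed_sub s : disjointed s `<=` U s.
Proof. by case: s => [|k s] // x [_ []]. Qed.

Lemma disjointed_inj s t x : size s = size t ->
  disjointed s x -> disjointed t x -> s = t.
Proof.
elim: s t => [|k s IH] [|j t] //= [st] [sx [Uks nks]] [tx [Ujt njt]].
have {}st := IH t st sx tx; rewrite -{t}st in tx Ujt njt *.
have [kj|jk|-> //] := ltngtP k j.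
  by exfalso; apply: njt; apply: subset_closure; exists k.
by exfalso; apply: nks; apply: subset_closure; exists j.
Qed.

(** An open set that meets [disjointed s] meets some [U (k :: s)] there, since
the set [P s] is non-meager in it and is covered by the countably many
[P (k :: s)]. For the least such [k], the open set has a part that is disjoint
from all earlier siblings, hence from their closure. *)
Lemma disjointed_nowhere_dense s :
  nowhere_dense (disjointed s `\` \bigcup_k disjointed (k :: s)).
Proof.
apply/nowhere_denseP => W oW [x Wx].
have [Vx|nV] := pselect (W `&` disjointed s !=set0); last first.
  by exists W; split => //; [exists x|move=> z Wz [Vz _]; apply: nV; exists z].
have oWV : open (W `&` disjointed s) by apply: openI => //; exact: open_disjointed.
have [k [y [[Wy Vy] Uy]] kmin] : exists2 k, (W `&` disjointed s) `&` U (k :: s) !=set0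
    & forall j, (j < k)%N -> ~ ((W `&` disjointed s) `&` U (j :: s) !=set0).
  suff exk : exists k, `[< (W `&` disjointed s) `&` U (k :: s) !=set0 >].
    have [m /asboolP Hm mmin] := ex_minnP exk.
    by exists m => // j jm /asboolP/mmin; rewrite leqNgt jm.
  apply: contrapT => nU.
  have : ~ meager (P s `&` (W `&` disjointed s)).
    have [y [Wy Vy]] := Vx; have [Q [oQ HQ] Qy] := disjointed_sub Vy => mP.
    apply: (HQ (Q `&` (W `&` disjointed s))); first exact: openI.
    - by exists y.
    - exact: subIsetl.
    - by apply: meagerS mP => z [Pz [_]].
  apply; apply: (@meagerS _ _ (\bigcup_k (P (k :: s) `&` (W `&` disjointed s)))).
    by move=> z [/P_cover[k _ Pk] WVz]; exists k.
  apply: meager_bigcup => k; apply: contrapT.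
  by move=> /(meet_everywhere_nonmeager rB oWV) H; apply: nU; exists k; apply/asboolP.
have oWU : open ((W `&` disjointed s) `&` U (k :: s)).
  apply: openI => //; exact: open_everywhere_nonmeager.
exists ((W `&` disjointed s) `&` U (k :: s)); split => //.
- by exists y.
- by move=> z [[]].
- move=> z Oz [_ nz]; apply: nz; exists k => //=.
  have [[Wz Vz] Uz] := Oz; split => //; split => // clz.
  have [t [[j jk Ut] WVt]] := clz _ (open_nbhs_nbhs (conj oWU Oz)).
  by apply: (kmin j jk); exists t; split => //; have [] := WVt.
Qed.

(** The exceptional set collects the points at which some [disjointed s] is not
covered by its children. *)
Lemma disjointed_branch : exists N, meager N /\
  forall x, U [::] x -> ~ N x -> exists a, forall n, disjointed (history a n) x.
Proof.
exists (\bigcup_s (disjointed s `\` \bigcup_k disjointed (k :: s))); split.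
  apply: meager_bigcup => s; apply: nowhere_dense_meager.
  exact: disjointed_nowhere_dense.
move=> x Ux nN.
have /choice[k kP] s : exists k, disjointed s x -> disjointed (k :: s) x.
  have [sx|] := pselect (disjointed s x); last by exists 0%N.
  apply: contrapT => H; apply: nN; exists s => //; split => // -[k _ kx].
  by apply: H; exists k.
pose fix sq n := if n is m.+1 then k (sq m) :: sq m else [::].
have sqE n : history (fun n => k (sq n)) n = sq n by elim: n => //= n ->.
exists (fun n => k (sq n)) => n; rewrite sqE.
by elim: n => //= n IH; exact: kP IH.
Qed.

End Disjointification.

(** Continuity of the restriction of [f] to [G], with [f] total. *)
Definition continuous_on (X Y : topologicalType) (G : set X) (f : X -> Y) :=
  forall x, G x -> forall O : set Y, open O -> O (f x) ->
    exists V : set X, [/\ open V, V x & forall z, V z -> G z -> O (f z)].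

(** A branch [a] codes two things in each digit: a digit of a branch that
witnesses membership in [A], and the index of a small basic set around the
second coordinate. A sequence [s] thus determines a set [H s] of possible
second coordinates, which gets small as [s] gets long. On the open set
[disjointed P s] all branches begin with [s], so the selector takes its values
in [H s] there, which makes it continuous. *)
Lemma suslin_uniformization (X Y : topologicalType) (B : nat -> set X)
    (B' : nat -> set Y) (small : nat -> set (set Y)) (A : set (X * Y)) :
  regular_base B -> regular_base B' -> complete_gauge small ->
  suslin A -> ~ meager (fst @` A) ->
  exists (U N : set X) (f : X -> Y), [/\ open U, U !=set0, meager N,
    forall x, (U `\` N) x -> A (x, f x) & continuous_on (U `\` N) f].
Proof.
move=> rB [oB' rB'] [small_sub small_nbhs complete] [C0 cC0 AE] nmA.
(* A default value for the selector outside its domain. *)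
have [y0 _] : exists y : Y, True.
  apply: contrapT => nY; apply: nmA; apply: meagerS (@meager0 X) => x [[x' y] _ _].
  by apply: nY; exists y.
pose dec n := odflt (0%N, 0%N) (@unpickle (nat * nat)%type n).
(* An index of a set that is not small is given the empty set, so that [E n k]
   is small without condition. *)
pose E n k := if pselect (small n (closure (B' (dec k).2)))
  then closure (B' (dec k).2) else set0.
have E_closed n k : closed (E n k).
  by rewrite /E; case: (pselect _) => /= ?; [exact: closed_closure|exact: closed0].
have E_small n k : small n (E n k).
  rewrite /E; case: (pselect _) => //= ?.
  by have [V [_ _ sV]] := small_nbhs n y0; apply: small_sub sV.
pose fix H s : set Y := if s is k :: s' then H s' `&` E (size s') k else setT.
have H_small a n : small n (H (history a n.+1)).
  by apply: small_sub (E_small n (a n)) => y [_]; rewrite size_history.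
pose C (z : X * Y) a := C0 z (fun n => (dec (a n)).1) /\ forall n, E n (a n) z.2.
have cC : tree_closed C.
  apply: tree_closed_and.
    apply: (@tree_closed_comp _ _ (fun a n => (dec (a n)).1) id) => //.
    by move=> a b i /= ->.
  apply: tree_closed_forall => n.
  apply: (@tree_closed_digit _ (fun k => snd @^-1` E n k)) => k.
  by apply: preimage_closed => // -[x y] _; exact: cvg_snd.
have CH z a n : C z a -> H (history a n) z.2.
  by move=> [_ Ez]; elim: n => //= n IH; split => //; rewrite size_history.
have CA z a : C z a -> A z by rewrite AE => -[Ca _]; eexists; exact: Ca.
have AC z : A z -> exists a, C z a.
  rewrite AE => -[a Ca].
  have /choice[k kP] n : exists k, small n (closure (B' k)) /\ B' k z.2.
    have [V [oV Vz sV]] := small_nbhs n z.2; have [k Bk BkV] := rB' V _ oV Vz.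
    by exists k; split => //; exact: small_sub sV.
  have decE n : dec (pickle (a n, k n)) = (a n, k n) by rewrite /dec pickleK.
  exists (fun n => pickle (a n, k n)); split.
    by rewrite (_ : (fun n => _) = a)//; apply/funext => n; rewrite decE.
  move=> n; rewrite /E decE; case: (pselect _) => /= [_|[]].
    exact: subset_closure (kP n).2.
  exact: (kP n).1.
pose P s := [set x | exists y a, history a (size s) = s /\ C (x, y) a].
have P_cover s : P s `<=` \bigcup_k P (k :: s).
  move=> x [y [a [as_ Ca]]]; exists (a (size s)) => //.
  by exists y, a; split => //=; rewrite as_.
have PE : P [::] = fst @` A.
  apply/seteqP; split => [x [y [a [_ /CA Az]]]|_ [[x y] /AC[a Ca] <-]].
    by exists (x, y).
  by exists y, a.
pose U := everywhere_nonmeager (P [::]).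
have [N [mN NP]] := disjointed_branch rB P_cover.
(* A point that stays in the open sets along [a] is in the projection of [A],
   with [a] itself as witness. *)
have branch_point x (a : nat -> nat) : (forall n, disjointed P (history a n) x) ->
    exists y, C (x, y) a /\ forall Q : set Y, open Q -> Q y ->
      exists n, H (history a n.+1) `<=` Q.
  move=> xa.
  have meetP n (Q : set X) : open Q -> Q x -> Q `&` P (history a n) !=set0.
    move=> oQ Qx; apply: everywhere_nonmeager_meet => //; exists x; split => //.
    exact: disjointed_sub (xa n).
  have HP n x' : P (history a n) x' -> exists y b,
      [/\ history b n = history a n, H (history a n) y & C (x', y) b].
    move=> [y [b [ba Cb]]]; rewrite size_history in ba.
    by exists y, b; split => //; rewrite -ba; exact: CH Cb.
  have H_le : forall m n, (m <= n)%N -> H (history a n) `<=` H (history a m).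
    by apply: nonincreasing_sets => n y [].
  have [||n|y yP] := complete (fun n => H (history a n.+1)).
  - move=> n; have [x' [_ /HP[y [b [_ Hy _]]]]] := meetP n.+1 setT openT I.
    by exists y.
  - by move=> n; apply: H_le.
  - exact: H_small.
  (* Near [(x, y)] there are points witnessed by branches that agree with [a] for
     as long as required: [x] is a limit of first coordinates, and [H] confines
     the second coordinates to neighbourhoods of [y]. *)
  exists y; split => //; apply: cC => W n oW Wxy.
  have [Q1 [Q2 [oQ1 oQ2 Q1x Q2y QW]]] := open_prodP oW Wxy.
  have [m HQ2] := yP Q2 oQ2 Q2y.
  have [x' [Q1x' /HP[y' [b [ba Hy' Cb]]]]] := meetP (maxn n m.+1) Q1 oQ1 Q1x.
  exists (x', y'), b; split => //.
    by apply: QW; split => //; apply: HQ2; apply: H_le Hy'; rewrite leq_maxr.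
  by apply: history_le ba; rewrite leq_maxl.
have /choice[h hP] x : exists p : Y * (nat -> nat), (U `\` N) x ->
    [/\ forall n, disjointed P (history p.2 n) x, C (x, p.1) p.2
      & forall Q : set Y, open Q -> Q p.1 ->
          exists n, H (history p.2 n.+1) `<=` Q].
  have [[Ux nNx]|] := pselect ((U `\` N) x); last by exists (y0, fun _ => 0%N).
  have [a xa] := NP x Ux nNx; have [y [Cy yP]] := branch_point x a xa.
  by exists (y, a).
exists U, N, (fun x => (h x).1); split => //.
- exact: open_everywhere_nonmeager.
- have nmP : ~ meager (P [::] `&` setT) by rewrite setIT PE.
  have [x [_ Ux]] := meet_everywhere_nonmeager rB openT nmP.
  by exists x.
- by move=> x /hP[_ + _]; exact: CA.
- move=> x /hP[xa Cx xlim] Q oQ Qx.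
  have [n HQ] := xlim Q oQ Qx.
  exists (disjointed P (history (h x).2 n.+1)); split => //.
    exact: open_disjointed.
  move=> z Vz /hP[za Cz _]; apply: HQ.
  have -> : history (h x).2 n.+1 = history (h z).2 n.+1.
    by apply: disjointed_inj Vz (za _); rewrite !size_history.
  exact: (CH (z, (h z).1) _ n.+1 Cz).
Qed.

(** * The Baire property *)

Lemma meager_setTX (S T : topologicalType) (N : set T) :
  meager N -> meager ([set: S] `*` N).
Proof.
move=> [F nF NF]; exists (fun n => [set: S] `*` F n).
  by move=> n; exact: nowhere_dense_setTX.
by move=> [s t] [_ /NF[n _ Fn]]; exists n.
Qed.

Definition baire_property (T : topologicalType) (S : set T) : Prop :=
  exists2 O : set T, open O & meager ((S `\` O) `|` (O `\` S)).

Lemma baire_property_open (T : topologicalType) (O : set T) :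
  open O -> baire_property O.
Proof. by move=> oO; exists O => //; rewrite setDv setU0; exact: meager0. Qed.

Lemma baire_property_meager (T : topologicalType) (M : set T) :
  meager M -> baire_property M.
Proof.
by move=> mM; exists set0; [exact: open0|rewrite setD0 set0D setU0].
Qed.

(** The complement agrees with the exterior of the approximating open set, up to
the boundary of that set, which is nowhere dense. *)
Lemma baire_propertyC (T : topologicalType) (S : set T) :
  baire_property S -> baire_property (~` S).
Proof.
move=> [Q oQ mS]; exists (~` closure Q).
  by apply: closed_openC; exact: closed_closure.
have nQ : nowhere_dense (closure Q `\` Q).
  apply/nowhere_denseP => W oW [x Wx].
  have [[y [Wy Qy]]|WQ] := pselect (W `&` Q !=set0).
    exists (W `&` Q); split; first exact: openI.
    - by exists y.
    - exact: subIsetl.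
    - by move=> z [Wz Qz] [].
  exists W; split => //; first by exists x.
  by move=> z Wz [/(_ W (open_nbhs_nbhs (conj oW Wz)))]; rewrite setIC.
apply: meagerS (meagerU mS (nowhere_dense_meager nQ)) => x.
move=> [[nSx /contrapT clQ]|[nclQ /contrapT Sx]].
  by have [Qx|nQx] := pselect (Q x); [left; right|right].
by left; left; split => // Qx; apply: nclQ; exact: subset_closure.
Qed.

Lemma baire_property_bigcup (T : topologicalType) (S : nat -> set T) :
  (forall n, baire_property (S n)) -> baire_property (\bigcup_n S n).
Proof.
move=> bS.
have /choice[Q HQ] n : exists Q : set T,
    open Q /\ meager ((S n `\` Q) `|` (Q `\` S n)).
  by have [Q oQ mQ] := bS n; exists Q.
exists (\bigcup_n Q n); first by apply: bigcup_open => n _; exact: (HQ n).1.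
apply: (@meagerS _ _ (\bigcup_n ((S n `\` Q n) `|` (Q n `\` S n)))).
  move=> x [[[n _ Sx] nQ]|[[n _ Qx] nS]]; exists n => //.
    by left; split => // Qx; apply: nQ; exists n.
  by right; split => // Sx; apply: nS; exists n.
by apply: meager_bigcup => n; exact: (HQ n).2.
Qed.

Lemma baire_propertyU (T : topologicalType) (S S' : set T) :
  baire_property S -> baire_property S' -> baire_property (S `|` S').
Proof.
move=> bS bS'; rewrite -bigcup2E; apply: baire_property_bigcup => -[|[|n]] //=.
by apply: baire_property_open; exact: open0.
Qed.

Lemma baire_propertyI (T : topologicalType) (S S' : set T) :
  baire_property S -> baire_property S' -> baire_property (S `&` S').
Proof.
move=> bS bS'; rewrite -[_ `&` _]setCK setCI; apply: baire_propertyC.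
by apply: baire_propertyU; exact: baire_propertyC.
Qed.

(** For open [A], continuity of [f] on [G] makes the pullback the trace on
[[set: X] `*` G] of an open set; the sets [A] whose pullback has the Baire
property form a sigma-algebra. *)
Lemma baire_property_pullback (X Y : topologicalType) (G : set X) (f : X -> Y)
    (A : set (X * Y)) :
  baire_property ([set: X] `*` G) -> continuous_on G f -> borel A ->
  baire_property [set p : X * X | G p.2 /\ A (p.1, f p.2)].
Proof.
move=> bG cf; pose pb A := [set p : X * X | G p.2 /\ A (p.1, f p.2)].
apply: (smallest_sub (X := [set A | baire_property (pb A)])).
  split.
  - rewrite /= (_ : pb set0 = set0); first exact/baire_property_open/open0.
    by apply/seteqP; split => // p [].
  - move=> F bF; rewrite /= (_ : pb _ = ([set: X] `*` G) `&` ~` pb F).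
      by apply: baire_propertyI => //; exact: baire_propertyC.
    apply/seteqP; split => [p [Gp [_ nF]]|p [[_ Gp] nF]]; split => //.
      by move=> [].
    by split => // Fp; apply: nF.
  - move=> F bF; rewrite /= (_ : pb _ = \bigcup_n pb (F n)).
      exact: baire_property_bigcup.
    apply/seteqP; split => [p [Gp [n _ Fn]]|p [n _ [Gp Fn]]]; first by exists n.
    by split => //; exists n.
move=> W oW /=.
pose good (R : set X * set X) := [/\ open R.1, open R.2
  & forall x z, R.1 x -> R.2 z -> G z -> W (x, f z)].
rewrite (_ : pb W = (\bigcup_(R in good) (R.1 `*` R.2)) `&` ([set: X] `*` G)).
  apply: baire_propertyI => //; apply: baire_property_open.
  by apply: bigcup_open => R [oR1 oR2 _]; exact: open_setX.
apply/seteqP; split => [[x z] [Gz Wxz]|[x z] [[R [_ _ RW] [Rx Rz]] [_ Gz]]].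
  have [P [Q [oP oQ Px Qz PQW]]] := open_prodP oW Wxz.
  have [V [oV Vz VQ]] := cf z Gz Q oQ Qz.
  split => //; exists (P, V) => //; split => // s t /= Ps Vt Gt.
  by apply: PQW; split => //; exact: VQ.
by split => //; exact: RW.
Qed.

(** Half of the Kuratowski-Ulam theorem. If [M] were not meager it would be
comeager in a nonempty open rectangle, so almost all of its sections would be
comeager in a nonempty open set, and Baire's theorem forbids them to be meager. *)
Lemma meager_of_meager_sections (X : topologicalType) (B : nat -> set X)
    (small : nat -> set (set X)) (M : set (X * X)) :
  regular_base B -> complete_gauge small -> baire_property M ->
  (forall z, meager [set x | M (x, z)]) -> meager M.
Proof.
move=> rB cg [Q oQ mMQ] secM.
apply: (@meagerS _ _ ((M `\` Q) `|` (Q `\` M))); last exact: mMQ.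
suff Q0 : ~ (Q !=set0) by move=> p Mp; left; split => // Qp; apply: Q0; exists p.
move=> [[x z] Qxz].
have [P [V [oP oV Px Vz PVQ]]] := open_prodP oQ Qxz.
have [E mE HE] := kuratowski_ulam rB mMQ.
have [t [Vt nEt]] : exists t, V t /\ ~ E t.
  apply: contrapT => H; apply: (baire rB cg oV (ex_intro _ z Vz)).
  apply: meagerS mE => t Vt; apply: contrapT => nEt; apply: H; by exists t.
apply: (baire rB cg oP (ex_intro _ x Px)).
apply: meagerS (meagerU (HE t nEt) (secM t)) => s Ps.
have [Ms|nMs] := pselect (M (s, t)); first by right.
by left; right; split => //; apply: PVQ.
Qed.

(** * The Cantor set in general position *)

(** A continuous injection of a compact space into a Hausdorff space is closed, so
its inverse on the range is continuous. *)
Lemma cantor_embedding (T : topologicalType) (h : cantor_space -> T) :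
  hausdorff_space T -> continuous h -> injective h ->
  exists e : cantor_space -> set_type (range h),
    homeomorphism e /\ forall c, set_val (e c) = h c.
Proof.
move=> hT ch ih.
have hr c : h c \in range h by apply: mem_set; exists c.
pose e c : set_type (range h) := exist _ (h c) (hr c).
have /choice[k kP] (x : set_type (range h)) : exists c, h c = set_val x.
  by have [c _ cx] := set_mem (valP x); exists c.
have ek : cancel e k by move=> c; apply: ih; rewrite kP.
have ke : cancel k e by move=> x; apply: val_inj; exact: kP.
exists e; split => //; exists k; split => //.
- apply/continuousP => W [Q oQ <-].
  by move/continuousP: ch; exact.
- apply/continuous_closedP => F cF.
  have -> : k @^-1` F = set_val @^-1` (h @` F).
    apply/seteqP; split => [x Fx|x [c Fc cx]]; first by exists (k x).
    by rewrite /preimage /= (_ : k x = c)//; apply: ih; rewrite kP.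
  have cval : continuous (set_val : set_type (range h) -> T).
    exact: initial_continuous.
  move/continuous_closedP: cval; apply; apply: compact_closed => //.
  apply: continuous_compact; first exact: continuous_subspaceT.
  by apply: (@subclosed_compact _ _ [set: cantor_space]) => //; exact: cantor_space_compact.
Qed.

Theorem mainTheorem5 (R : realType) (X Y : topologicalType)
    (polishX : polish R X) (polishY : polish R Y)
    (A : set (X * Y)) (borelA : borel A)
    (meager_sections : forall y : Y, meager [set x : X | A (x, y)])
    (nonmeager_proj : ~ meager (fst @` A)) :
  exists (P : set X) (Q : set Y) (phi : set_type P -> set_type Q),
    [/\ cantor_copy P, cantor_copy Q, homeomorphism phi
      & graph phi = (P `*` Q) `&` A].
Proof.
have [BX rBX] := polish_regular_base polishX.
have [BY rBY] := polish_regular_base polishY.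
have [sX cgX] := polish_complete_gauge polishX.
have [sY cgY] := polish_complete_gauge polishY.
have suslinA : suslin A.
  by apply: borel_suslin borelA => W; exact: open_prod_Fsigma rBX rBY.
have [U [N [f [oU U0 mN Af cf]]]] :=
  suslin_uniformization rBX rBY cgY suslinA nonmeager_proj.
pose M := [set p : X * X | (U `\` N) p.2 /\ A (p.1, f p.2)].
have mM : meager M.
  apply: meager_of_meager_sections rBX cgX _ _.
    apply: (baire_property_pullback _ cf borelA).
    rewrite (_ : _ `*` _ = ([set: X] `*` U) `&` ~` ([set: X] `*` N)).
      apply: baire_propertyI.
        by apply: baire_property_open; apply: open_setX => //; exact: openT.
      by apply/baire_propertyC/baire_property_meager; exact: meager_setTX.
    apply/seteqP; split => [p [_ [Up nN]]|p [[_ Up] nN]]; split => //.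
      by move=> [].
    by split => // Np; apply: nN.
  by move=> z; apply: meagerS (meager_sections (f z)) => x [].
(* Avoiding the cylinder over [N] keeps the points of the scheme in the domain of
   [f]. *)
have [F nF MF] := meagerU mM (meager_setTX X mN).
have [g [cg Ug gF]] := cantor_scheme rBX cgX oU U0 nF.
have gM c d : c <> d -> ~ (M `|` [set: X] `*` N) (g c, g d).
  by move=> cd /MF[n _]; exact: gF.
have gG c : (U `\` N) (g c).
  split => // Ngc; have [d dc] : exists d : cantor_space, d <> c.
    exists (fun n => ~~ c n) => /(congr1 (fun e : cantor_space => e 0%N)).
    by case: (c 0%N).
  by apply: (gM d c dc); right.
have gA c d : A (g c, f (g d)) -> c = d.
  move=> Acd; apply: contrapT => /gM; apply; left; split => //; exact: gG.
(* Both maps are injective because [(g d, f (g d))] is in [A]: equal values at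
   distinct [c] and [d] would put [(g c, f (g d))] in [A]. *)
have fg_inj : injective (f \o g).
  by move=> c d /= fcd; apply: gA; rewrite -fcd; apply: Af.
have g_inj : injective g by move=> c d gcd; apply: fg_inj; rewrite /= gcd.
have cfg : continuous (f \o g).
  move=> c W; rewrite nbhsE => -[Q [oQ Qc] QW].
  have [V [oV Vc VQ]] := cf _ (gG c) Q oQ Qc.
  have gV : nbhs c (g @^-1` V) := cg c V (open_nbhs_nbhs (conj oV Vc)).
  by apply: filterS gV => d Vd; apply/QW/VQ.
have [e [[k [ek ke ce ck]] eg]] := cantor_embedding (polish_hausdorff polishX) cg g_inj.
have [e' [[k' [e'k' k'e' ce' ck']] e'fg]] :=
  cantor_embedding (polish_hausdorff polishY) cfg fg_inj.
exists (range g), (range (f \o g)), (e' \o k); split.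
- by exists k, e.
- by exists k', e'.
- exists (e \o k'); split.
  + by move=> x /=; rewrite e'k' ke.
  + by move=> y /=; rewrite ek k'e'.
  + by move=> x; apply: continuous_comp; [exact: ck|exact: ce'].
  + by move=> y; apply: continuous_comp; [exact: ck'|exact: ce].
- apply/seteqP; split => [_ [x _ <-]|[_ _] [[/= [c _ <-] [d _ <-]] /gA cd]].
    rewrite -[x]ke /= ek eg e'fg; split; last exact: Af.
    by split; [exists (k x)|exists (k x)].
  by exists (e c) => //=; rewrite ek eg e'fg cd.
Qed.
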